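(* Let $\Omega\subset\mathbb{C}^d$ be a Kobayashi hyperbolic domain such that $(\Omega,\mathsf{k}_\Omega)$ is a Gromov hyperbolic metric space, and suppose the identity map of $\Omega$ extends to a homeomorphism from the Gromov compactification $\overline{\Omega}^{G}$ of $(\Omega,\mathsf{k}_\Omega)$ onto the end-point compactification $\overline{\Omega}^{End}$ of $\Omega$. Then for every $x\in\partial\Omega$, $o\in\Omega$ and $R>0$, $\overline{H^s_o(x,R)}\cap\partial\Omega=\overline{H^b_o(x,R)}\cap\partial\Omega=\{x\}$.
   Context: For a Kobayashi hyperbolic domain $\Omega\subset\mathbb{C}^d$ with Kobayashi distance $\mathsf{k}_\Omega$, a point $x\in\partial\Omega$ (boundary in $\mathbb{C}^d$), a pole $o\in\Omega$ and $R>0$, the small horosphere and big horosphere are $H^s_o(x,R)=\{z\in\Omega:\limsup_{w\to x}(\mathsf{k}_\Omega(z,w)-\mathsf{k}_\Omega(o,w))<\tfrac12\log R\}$, $H^b_o(x,R)=\{z\in\Omega:\liminf_{w\to x}(\mathsf{k}_\Omega(z,w)-\mathsf{k}_\Omega(o,w))<\tfrac12\log R\}$; closures are taken in $\mathbb{C}^d$. The Gromov compactification $\overline{\Omega}^G=\Omega\cup\partial_G\Omega$ is the standard compactification of the proper geodesic Gromov hyperbolic space $(\Omega,\mathsf{k}_\Omega)$ by equivalence classes of geodesic rays / sequences converging at infinity. The end-point compactification $\overline{\Omega}^{End}$ is the closure $\overline{\Omega}\subset\mathbb{C}^d$ together with one additional point for each end of $\Omega$ at infinity; for bounded $\Omega$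 it equals $\overline{\Omega}$. A domain satisfying the hypotheses is called model-Gromov-hyperbolic. *)

(* Defs.v *)
From Stdlib Require Import Reals.
From Coquelicot Require Import Coquelicot.
From mathcomp Require Import ssreflect ssrbool ssrnat fintype bigop.

Set Implicit Arguments.
Unset Strict Implicit.

Local Open Scope R_scope.

Definition pt (d : nat) := 'I_d -> C.

Definition pnorm {d : nat} (x : pt d) : R :=
  sqrt (\big[Rplus/0]_(j < d) (Cmod (x j)) ^ 2).

Definition pdist {d : nat} (x y : pt d) : R := pnorm (fun j => (x j - y j)%C).

Definition open_set {d : nat} (U : pt d -> Prop) : Prop :=
  forall x, U x -> exists r, 0 < r /\ forall y, pdist x y < r -> U y.

Definition connected_set {d : nat} (A : pt d -> Prop) : Prop :=
  ~ (exists U V : pt d -> Prop,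
        open_set U /\ open_set V /\
        (forall x, A x -> U x \/ V x) /\
        (exists x, A x /\ U x) /\ (exists x, A x /\ V x) /\
        (forall x, A x -> U x -> V x -> False)).

Definition domain {d : nat} (Om : pt d -> Prop) : Prop :=
  open_set Om /\ connected_set Om /\ exists z, Om z.

Definition closure_set {d : nat} (A : pt d -> Prop) (x : pt d) : Prop :=
  forall r, 0 < r -> exists y, A y /\ pdist x y < r.

Definition boundary {d : nat} (A : pt d -> Prop) (x : pt d) : Prop :=
  closure_set A x /\ ~ A x.

(* Poincare distance on the unit disc (curvature -4 normalisation:
   rho(a,b) = artanh |(a-b)/(1 - conj(a) b)|). *)
Definition poincare (a b : C) : R :=
  let t := Cmod (a - b)%C / Cmod (1 - Cconj a * b)%C in
  ln ((1 + t) / (1 - t)) / 2.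

Definition holo_disc {d : nat} (Om : pt d -> Prop) (f : C -> pt d) : Prop :=
  forall z : C, Cmod z < 1 ->
    Om (f z) /\
    forall j : 'I_d, @ex_derive C_AbsRing C_NormedModule (fun w => f w j) z.

Definition kob_chain {d : nat} (Om : pt d -> Prop) (z w : pt d) (L : R) : Prop :=
  exists (n : nat) (f : nat -> C -> pt d) (a b : nat -> C),
    (0 < n)%N /\
    (forall j, (j < n)%N ->
        holo_disc Om (f j) /\ Cmod (a j) < 1 /\ Cmod (b j) < 1) /\
    f 0%N (a 0%N) = z /\
    (forall j, (j.+1 < n)%N -> f j (b j) = f j.+1 (a j.+1)) /\
    f n.-1 (b n.-1) = w /\
    L = \big[Rplus/0]_(j < n) poincare (a j) (b j).

Definition kobd {d : nat} (Om : pt d -> Prop) (z w : pt d) : R :=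
  real (Glb_Rbar (kob_chain Om z w)).

Definition kobayashi_hyperbolic {d : nat} (Om : pt d -> Prop) : Prop :=
  domain Om /\
  forall z w, Om z -> Om w -> z <> w -> 0 < kobd Om z w.

Definition gprod {d : nat} (Om : pt d -> Prop) (o x y : pt d) : R :=
  (kobd Om x o + kobd Om y o - kobd Om x y) / 2.

Definition gromov_hyperbolic {d : nat} (Om : pt d -> Prop) : Prop :=
  exists delta, 0 <= delta /\
    forall o x y z, Om o -> Om x -> Om y -> Om z ->
      gprod Om o x z >= Rmin (gprod Om o x y) (gprod Om o y z) - delta.

Definition conv_inf {d : nat} (Om : pt d -> Prop) (p : pt d) (s : nat -> pt d) : Prop :=
  (forall n, Om (s n)) /\
  forall M, exists N, forall m n, (N <= m)%N -> (N <= n)%N -> gprod Om p (s m) (s n) > M.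

Definition seq_equiv {d : nat} (Om : pt d -> Prop) (p : pt d) (s t : nat -> pt d) : Prop :=
  forall M, exists N, forall n, (N <= n)%N -> gprod Om p (s n) (t n) > M.

Definition gclass (d : nat) := (nat -> pt d) -> Prop.

Definition gbdry {d : nat} (Om : pt d -> Prop) (p : pt d) (xi : gclass d) : Prop :=
  exists s, conv_inf Om p s /\
    forall t, xi t <-> (conv_inf Om p t /\ seq_equiv Om p s t).

Definition gpoint {d : nat} (Om : pt d -> Prop) (p : pt d) (q : pt d + gclass d) : Prop :=
  match q with
  | inl z => Om z
  | inr xi => gbdry Om p xi
  end.

(* (q | xi)_p >= N, where (q|xi)_p is the infimum over representatives
   of the liminf of Gromov products *)
Definition gprod_ge {d : nat} (Om : pt d -> Prop) (p : pt d)
    (q : pt d + gclass d) (xi : gclass d) (N : R) : Prop :=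
  match q with
  | inl y => forall s, xi s -> Rbar_le N (LimInf_seq (fun n => gprod Om p y (s n)))
  | inr eta => forall s t, xi s -> eta t ->
                 Rbar_le N (LimInf_seq (fun n => gprod Om p (t n) (s n)))
  end.

Definition gopen {d : nat} (Om : pt d -> Prop) (p : pt d)
    (U : pt d + gclass d -> Prop) : Prop :=
  (forall q, U q -> gpoint Om p q) /\
  (forall z, U (inl z) ->
     exists r, 0 < r /\ forall w, Om w -> kobd Om z w < r -> U (inl w)) /\
  (forall xi, U (inr xi) ->
     exists N, forall q, gpoint Om p q -> gprod_ge Om p q xi N -> U q).

Definition cball {d : nat} (n : nat) (x : pt d) : Prop :=
  pnorm x <= INR n.

Definition component {d : nat} (A C : pt d -> Prop) : Prop :=
  (exists x, C x) /\ (forall x, C x -> A x) /\ connected_set C /\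
  forall B, connected_set B -> (forall x, C x -> B x) -> (forall x, B x -> A x) ->
    forall x, B x -> C x.

Definition eclass (d : nat) := nat -> pt d -> Prop.

Definition is_end {d : nat} (Om : pt d -> Prop) (e : eclass d) : Prop :=
  (forall n, component (fun x => closure_set Om x /\ ~ cball n x) (e n)) /\
  (forall n x, e n.+1 x -> e n x).

Definition epoint {d : nat} (Om : pt d -> Prop) (q : pt d + eclass d) : Prop :=
  match q with
  | inl x => closure_set Om x
  | inr e => is_end Om e
  end.

Definition eopen {d : nat} (Om : pt d -> Prop) (U : pt d + eclass d -> Prop) : Prop :=
  (forall q, U q -> epoint Om q) /\
  (forall x, U (inl x) ->
     exists r, 0 < r /\ forall y, closure_set Om y -> pdist x y < r -> U (inl y)) /\
  (forall e, U (inr e) ->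
     exists n, (forall y, closure_set Om y -> e n y -> U (inl y)) /\
               (forall e', is_end Om e' -> e' n = e n -> U (inr e'))).

Definition id_extends_homeo {d : nat} (Om : pt d -> Prop) (p : pt d) : Prop :=
  exists h : pt d + gclass d -> pt d + eclass d,
    (forall z, Om z -> h (inl z) = inl z) /\
    (forall q, gpoint Om p q -> epoint Om (h q)) /\
    (forall q q', gpoint Om p q -> gpoint Om p q' -> h q = h q' -> q = q') /\
    (forall y, epoint Om y -> exists q, gpoint Om p q /\ h q = y) /\
    (forall U, (forall q, U q -> gpoint Om p q) ->
       (gopen Om p U <-> eopen Om (fun y => exists q, U q /\ h q = y))).

Definition model_gromov_hyperbolic {d : nat} (Om : pt d -> Prop) : Prop :=
  kobayashi_hyperbolic Om /\ gromov_hyperbolic Om /\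
  exists p, Om p /\ id_extends_homeo Om p.

Definition limsup_lt {d : nat} (Om : pt d -> Prop) (x : pt d) (F : pt d -> R) (c : R) : Prop :=
  exists c', c' < c /\ exists r, 0 < r /\
    forall w, Om w -> pdist w x < r -> w <> x -> F w <= c'.

Definition liminf_lt {d : nat} (Om : pt d -> Prop) (x : pt d) (F : pt d -> R) (c : R) : Prop :=
  exists c', c' < c /\ forall r, 0 < r ->
    exists w, Om w /\ pdist w x < r /\ w <> x /\ F w < c'.

Definition small_horosphere {d : nat} (Om : pt d -> Prop) (o x : pt d) (R0 : R) (z : pt d) : Prop :=
  Om z /\ limsup_lt Om x (fun w => kobd Om z w - kobd Om o w) (ln R0 / 2).

Definition big_horosphere {d : nat} (Om : pt d -> Prop) (o x : pt d) (R0 : R) (z : pt d) : Prop :=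
  Om z /\ liminf_lt Om x (fun w => kobd Om z w - kobd Om o w) (ln R0 / 2).

(* Main.v *)
(* Since the identity extends to a homeomorphism, a boundary point [x] is a Gromov
   boundary point [xi], and with respect to any pole [o] this says that [(u|w)_o]
   is large for [u], [w] close to [x], and conversely that [z] is close to [x] as
   soon as [(z|w)_o] is large for one [w] close enough to [x].

   If [z] is in the big horosphere at [x] then
   [2 (z|w)_o >= k(z,o) - log R / 2] for some [w] arbitrarily close to [x]; as
   [k(z,o)] tends to infinity at the boundary, a boundary point in the closure can
   only be [x].  Conversely, let [u] be close to [x] and let [z] lie at distance
   about [T] from [o] on an almost geodesic from [o] to [u].  Then [(z|u)_o], hence
   [(z|w)_o] for all [w] close to [x], is at least [T] up to a constant, so
   [k(z,w) - k(o,w) = k(z,o) - 2 (z|w)_o] is at most [-T] up to a constant: [z] is in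
   the small horosphere, and [z] tends to [x] as [T] grows. *)

Require Import Defs.
From Stdlib Require Import Reals Lra FunctionalExtensionality Classical_Prop.
From Coquelicot Require Import Coquelicot.
From mathcomp Require Import ssreflect ssrfun ssrbool eqtype ssrnat seq fintype bigop.
Local Open Scope R_scope.

(** * The Poincaré distance on the unit disc and the disc automorphisms *)

Definition artanh (t : R) : R := ln ((1 + t) / (1 - t)) / 2.

Lemma artanh_ge0 (t : R) : 0 <= t < 1 -> 0 <= artanh t.
Proof.
move=> [h0 h1]; rewrite /artanh.
have h : 1 <= (1 + t) / (1 - t).
  by apply: (Rmult_le_reg_r (1 - t)); [lra | field_simplify; lra].
case: h => [h|<-]; last by rewrite ln_1; lra.
by have := ln_increasing 1 _ Rlt_0_1 h; rewrite ln_1; lra.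
Qed.

(** This is what makes the Poincaré distance additive along a radius of the disc. *)
Lemma artanh_sub (s t : R) : 0 <= s < 1 -> 0 <= t < 1 -> s <= t ->
  artanh ((t - s) / (1 - s * t)) = artanh t - artanh s.
Proof.
move=> hs ht hst; rewrite /artanh.
have st : s * t < 1 by nra.
have -> : (1 + (t - s) / (1 - s * t)) / (1 - (t - s) / (1 - s * t)) =
  (1 + t) / (1 - t) / ((1 + s) / (1 - s)).
  by field; repeat split; nra.
have p u : 0 <= u < 1 -> 0 < (1 + u) / (1 - u).
  by move=> hu; apply: Rdiv_lt_0_compat; lra.
by rewrite ln_div; [lra | exact: p | exact: p].
Qed.

Lemma artanh_surj (T : R) : 0 <= T -> exists s, 0 <= s < 1 /\ artanh s = T.
Proof.
move=> hT; have e1 : 1 <= exp (2 * T).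
  by case: (Req_dec T 0) => [->|h]; [rewrite Rmult_0_r exp_0; lra|
    have := exp_ineq1 (2 * T); lra].
exists ((exp (2 * T) - 1) / (exp (2 * T) + 1)); split.
  split; first by apply: Rdiv_le_0_compat; lra.
  by apply: (Rmult_lt_reg_r (exp (2 * T) + 1)); [lra | field_simplify; lra].
rewrite /artanh.
have -> : (1 + (exp (2 * T) - 1) / (exp (2 * T) + 1)) /
          (1 - (exp (2 * T) - 1) / (exp (2 * T) + 1)) = exp (2 * T).
  by field; lra.
by rewrite ln_exp; lra.
Qed.

Lemma artanh_lt (s t : R) : 0 <= s < 1 -> 0 <= t < 1 -> t < s -> artanh t < artanh s.
Proof.
move=> hs ht hst; rewrite /artanh.
have p u : 0 <= u < 1 -> 0 < (1 + u) / (1 - u).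
  by move=> hu; apply: Rdiv_lt_0_compat; lra.
have := ln_increasing ((1 + t) / (1 - t)) ((1 + s) / (1 - s)) (p _ ht).
have : (1 + t) / (1 - t) < (1 + s) / (1 - s).
  apply: (Rmult_lt_reg_r ((1 - t) * (1 - s))); first nra.
  by field_simplify; lra.
lra.
Qed.

Local Open Scope C_scope.

(** For [a], [z] in the disc the right-hand side is positive. This keeps the denominator of [pseudo]
    away from 0 and its value below 1. *)
Lemma Cmod_pseudo (a z : C) :
  (Cmod (1 - Cconj a * z) ^ 2 - Cmod (a - z) ^ 2 =
   (1 - Cmod a ^ 2) * (1 - Cmod z ^ 2))%R.
Proof. by rewrite !Cmod2_alt; case: a => a1 a2; case: z => z1 z2 /=; ring. Qed.

Lemma one_sub_conj_neq0 (a z : C) :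
  (Cmod a < 1)%R -> (Cmod z < 1)%R -> 1 - Cconj a * z <> 0.
Proof.
move=> ha hz h; have := Cmod_pseudo a z; rewrite h Cmod_0.
have [? ?] := (Cmod_ge_0 a, Cmod_ge_0 z).
have := pow2_ge_0 (Cmod (a - z)).
have : (0 < (1 - Cmod a ^ 2) * (1 - Cmod z ^ 2))%R by apply: Rmult_lt_0_compat; nra.
by move=> ? ?; lra.
Qed.

Definition pseudo (a z : C) : R := Cmod (a - z) / Cmod (1 - Cconj a * z).

Lemma poincareE (a z : C) : poincare a z = artanh (pseudo a z).
Proof. by []. Qed.

Lemma pseudo_bound (a z : C) : (Cmod a < 1)%R -> (Cmod z < 1)%R ->
  (0 <= pseudo a z < 1)%R.
Proof.
move=> ha hz; have /Cmod_gt_0 hD := one_sub_conj_neq0 _ _ ha hz.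
have [? ?] := (Cmod_ge_0 a, Cmod_ge_0 z).
split; first exact: Rdiv_le_0_compat (Cmod_ge_0 _) hD.
apply: (Rmult_lt_reg_r _ _ _ hD); rewrite /pseudo /Rdiv Rmult_assoc Rinv_l; last lra.
have := Cmod_pseudo a z; have := Cmod_ge_0 (a - z).
have : (0 < (1 - Cmod a ^ 2) * (1 - Cmod z ^ 2))%R by apply: Rmult_lt_0_compat; nra.
by move=> *; nra.
Qed.

Lemma poincare_ge0 (a z : C) : (Cmod a < 1)%R -> (Cmod z < 1)%R ->
  (0 <= poincare a z)%R.
Proof. by move=> ha hz; apply/artanh_ge0/pseudo_bound. Qed.

Lemma poincare_sym (a z : C) : poincare a z = poincare z a.
Proof.
rewrite !poincareE /pseudo -[Cmod (z - a)]Cmod_opp -[Cmod (1 - Cconj z * a)]Cmod_conj.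
rewrite Cminus_conj Cmult_conj Cconj_conj.
by congr (artanh (Cmod _ / Cmod _)); rewrite /Cconj; case: z => *; case: a => * /=;
  rewrite /Cminus /Cplus /Cmult /Copp /=; congr pair; ring.
Qed.

Lemma poincare_refl (a : C) : poincare a a = 0%R.
Proof.
rewrite poincareE /pseudo /Cminus Cplus_opp_r Cmod_0 /Rdiv Rmult_0_l /artanh.
by rewrite Rplus_0_r Rminus_0_r Rdiv_1_r ln_1; lra.
Qed.

Definition mobius (a z : C) : C := (z + a) / (1 + Cconj a * z).

Section Mobius.
Context (a : C) (ha : (Cmod a < 1)%R).

Lemma mobius_den (z : C) : (Cmod z < 1)%R -> 1 + Cconj a * z <> 0.
Proof.
move=> hz; rewrite (_ : _ + _ = 1 - Cconj a * - z); last by ring.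
by apply: one_sub_conj_neq0; rewrite ?Cmod_opp.
Qed.

(** Under the automorphism, [z - w] and [1 - Cconj z * w] pick up the factor [1 - Cconj a * a] and
    denominators of equal modulus, which cancel in the quotient. *)
Lemma pseudo_mobius (z w : C) : (Cmod z < 1)%R -> (Cmod w < 1)%R ->
  pseudo (mobius a z) (mobius a w) = pseudo z w.
Proof.
move=> hz hw.
have Dz := mobius_den _ hz; have Dw := mobius_den _ hw.
have hzw := one_sub_conj_neq0 _ _ hz hw; have haa := one_sub_conj_neq0 _ _ ha ha.
have Dz' : 1 + a * Cconj z <> 0.
  move=> h; apply: Dz; rewrite -[LHS]Cconj_conj Cplus_conj Cmult_conj Cconj_conj.
  have -> : Cconj 1 = 1 by rewrite /Cconj /=; congr pair; ring.
  by rewrite h /Cconj /=; congr pair; ring.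
have Ez : Cconj (mobius a z) = (Cconj z + Cconj a) / (1 + a * Cconj z).
  rewrite /mobius Cdiv_conj // !Cplus_conj Cmult_conj Cconj_conj.
  by congr (_ / (_ + _)); rewrite /Cconj /=; congr pair; ring.
have E1 : Cmod (1 + a * Cconj z) = Cmod (1 + Cconj a * z).
  rewrite -Cmod_conj Cplus_conj Cmult_conj Cconj_conj.
  by congr (Cmod (_ + _)); rewrite /Cconj /=; congr pair; ring.
rewrite /pseudo.
have -> : mobius a z - mobius a w =
  (z - w) * (1 - Cconj a * a) / ((1 + Cconj a * z) * (1 + Cconj a * w)).
  by rewrite /mobius; field; split.
have -> : 1 - Cconj (mobius a z) * mobius a w =
  (1 - Cconj z * w) * (1 - Cconj a * a) / ((1 + a * Cconj z) * (1 + Cconj a * w)).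
  by rewrite Ez /mobius; field; split.
rewrite !Cmod_div ?Cmod_mult ?E1; try exact: Cmult_neq_0.
by field; repeat split; apply: Rgt_not_eq; apply/Cmod_gt_0.
Qed.

Lemma mobius_lt1 (z : C) : (Cmod z < 1)%R -> (Cmod (mobius a z) < 1)%R.
Proof.
move=> hz; have hD := mobius_den _ hz.
have [|_] := pseudo_bound a (- z) ha; first by rewrite Cmod_opp.
rewrite /pseudo /mobius Cmod_div //.
rewrite (_ : a - - z = z + a); last by ring.
by rewrite (_ : 1 - Cconj a * - z = 1 + Cconj a * z) //; ring.
Qed.
End Mobius.

(** The disc is a geodesic space: an automorphism moves [a] to 0, where the geodesic to the image of
    [b] is a radius and [artanh_sub] applies. *)
Lemma poincare_between (a b : C) (T : R) :
  (Cmod a < 1)%R -> (Cmod b < 1)%R -> (0 <= T <= poincare a b)%R ->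
  exists c, (Cmod c < 1)%R /\ poincare a c = T /\ poincare c b = (poincare a b - T)%R.
Proof.
move=> ha hb [hT0]; rewrite poincareE; set t := pseudo a b => hT.
have ht : (0 <= t < 1)%R := pseudo_bound _ _ ha hb.
have Dab := one_sub_conj_neq0 _ _ ha hb; have Daa := one_sub_conj_neq0 _ _ ha ha.
have art0 : artanh 0 = 0%R.
  by rewrite /artanh Rplus_0_r Rminus_0_r Rdiv_1_r ln_1; lra.
have [s [hs sT]] := artanh_surj T hT0.
(* The point [q] below is defined by a division by [t]. *)
have [t0|t0] := Req_dec t 0.
  move: hT; rewrite t0 art0 => hT; exists a; rewrite poincare_refl poincareE -/t t0 art0.
  by repeat split => //; lra.
have hst : (s <= t)%R.
  by case: (Rle_lt_dec s t) => // /(artanh_lt _ _ hs ht); lra.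
(* [m] is the image of [b] under the automorphism taking [a] to 0, and [q] is the point of modulus
   [s] on the segment from 0 to [m]. The required point is the image of [q] under the inverse
   automorphism [mobius a]. *)
pose m := (b - a) / (1 - Cconj a * b); pose q := RtoC (s / t) * m.
have mt : Cmod m = t.
  by rewrite /m /t /pseudo Cmod_div // -[Cmod (b - a)]Cmod_opp; congr (Cmod _ / _)%R; ring.
have qs : Cmod q = s.
  rewrite /q Cmod_mult Cmod_R mt Rabs_right; first by field.
  by apply/Rle_ge/Rdiv_le_0_compat; lra.
have bE : b = mobius a m.
  rewrite /mobius /m; field; split => //.
  rewrite (_ : _ + _ = 1 - Cconj a * a) //; ring.
have aE : a = mobius a 0 by rewrite /mobius; field; rewrite Cmult_0_r Cplus_0_r; exact: C1_nz.
have h0 : (Cmod 0 < 1)%R by rewrite Cmod_0; lra.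
have hm : (Cmod m < 1)%R by lra.
have hq : (Cmod q < 1)%R by lra.
exists (mobius a q); split; first exact: mobius_lt1.
rewrite !poincareE; split.
  rewrite -sT {1}aE pseudo_mobius // /pseudo.
  rewrite (_ : 0 - q = - q); last ring.
  rewrite (_ : 1 - Cconj 0 * q = 1); last first.
    by rewrite (_ : Cconj 0 = 0); [ring | rewrite /Cconj /=; congr pair; ring].
  by rewrite Cmod_opp Cmod_1 qs Rdiv_1_r.
rewrite {1}bE pseudo_mobius // -sT -artanh_sub // /pseudo.
have -> : q - m = RtoC (s / t - 1) * m by rewrite /q RtoC_minus; ring.
have -> : 1 - Cconj q * m = RtoC (1 - s * t).
  rewrite /q Cmult_conj (_ : Cconj (RtoC (s / t)) = RtoC (s / t)); last first.
    by rewrite /Cconj /RtoC /=; congr pair; ring.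
  rewrite -Cmult_assoc [Cconj m * m]Cmult_comm -Cmod2_conj mt RtoC_minus.
  by rewrite -RtoC_mult; congr (_ - RtoC _)%C; field.
rewrite Cmod_mult !Cmod_R mt Rabs_left1; last first.
  by apply: (Rmult_le_reg_r t); [lra | field_simplify; lra].
rewrite Rabs_right; last by nra.
by congr (artanh (_ / _)); field.
Qed.

Local Close Scope C_scope.

(** * The Kobayashi distance *)

(** Inductive form of [kob_chain], so that chains can be concatenated, reversed and cut by
    induction. *)
Inductive kchain {d : nat} (Om : pt d -> Prop) : pt d -> pt d -> R -> Prop :=
| kchain_nil z : Om z -> kchain Om z z 0
| kchain_cons f a b w L : holo_disc Om f -> Cmod a < 1 -> Cmod b < 1 ->
    kchain Om (f b) w L -> kchain Om (f a) w (poincare a b + L).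

Section Chains.
Context {d : nat} (Om : pt d -> Prop).

Lemma kob_chain_kchain (z w : pt d) (L : R) : kob_chain Om z w L -> kchain Om z w L.
Proof.
move=> [n [f [a [b [n0 [hf [<- [hab [<- ->]]]]]]]]].
case: n n0 hf hab => // n _; elim: n f a b => [|n IH] f a b hf hab /=.
  rewrite big_ord_recl big_ord0; have [h [ha hb]] := hf 0%N isT.
  by apply: kchain_cons => //; apply: kchain_nil; case: (h _ hb).
rewrite big_ord_recl; have [h [ha hb]] := hf 0%N isT.
apply: kchain_cons => //; rewrite (hab 0%N) //.
by apply: (IH (fun j => f j.+1) (fun j => a j.+1) (fun j => b j.+1)) => j hj;
  [apply: hf | apply: hab].
Qed.

Lemma holo_disc_const (z : pt d) : Om z -> holo_disc Om (fun=> z).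
Proof. by move=> hz u _; split=> // j; apply: ex_derive_const. Qed.

Lemma kchain_kob_chain (z w : pt d) (L : R) : kchain Om z w L -> kob_chain Om z w L.
Proof.
elim=> {z w L} [z hz|f a b w L hf ha hb _ [n [g [a' [b' [n0 [hg [g0 [hab [gn ->]]]]]]]]]].
  (* [kob_chain] demands at least one disc, so the empty chain becomes one constant disc with equal
     parameters. *)
  exists 1%N, (fun _ _ => z), (fun=> 0%C), (fun=> 0%C).
  split=> //; split; first by move=> *; rewrite Cmod_0; split; [exact: holo_disc_const | lra].
  by do !split => //; rewrite big_ord_recl big_ord0 poincare_refl; ring.
case: n n0 hg hab gn => // n _ hg hab gn.
pose cons (T : Type) (x : T) (s : nat -> T) := fun j => if j is i.+1 then s i else x.
exists n.+2, (cons _ f g), (cons _ a a'), (cons _ b b').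
split=> //; split; first by case.
split; first by [].
split; first by case.
split; [exact: gn | by rewrite [RHS]big_ord_recl].
Qed.

Lemma kchain_in (z w : pt d) (L : R) : kchain Om z w L -> Om z /\ Om w.
Proof. by elim=> {z w L} [//|f a b w L hf ha hb _ [_ hw]]; split=> //; case: (hf a ha). Qed.

Lemma kchain_ge0 (z w : pt d) (L : R) : kchain Om z w L -> 0 <= L.
Proof.
elim=> {z w L} [*|f a b w L hf ha hb _ IH]; first lra.
by have := poincare_ge0 _ _ ha hb; lra.
Qed.

Lemma kchain_cat (z w u : pt d) (L M : R) :
  kchain Om z w L -> kchain Om w u M -> kchain Om z u (L + M).
Proof.
move=> h; elim: h M => {z w L} [z _ M|f a b w L hf ha hb _ IH M /IH h].
  by rewrite Rplus_0_l.
by rewrite Rplus_assoc; apply: kchain_cons.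
Qed.

Lemma kchain_sym (z w : pt d) (L : R) : kchain Om z w L -> kchain Om w z L.
Proof.
elim=> {z w L} [*|f a b w L hf ha hb _ IH]; first exact: kchain_nil.
rewrite Rplus_comm; apply: kchain_cat IH _.
rewrite poincare_sym -[poincare b a]Rplus_0_r; apply: kchain_cons => //.
by apply: kchain_nil; case: (hf a ha).
Qed.

(** The cut at length [T] falls inside one of the discs, where [poincare_between] provides a
    parameter that splits its length exactly. *)
Lemma kchain_split (z w : pt d) (L T : R) : kchain Om z w L -> 0 <= T <= L ->
  exists c, kchain Om z c T /\ kchain Om c w (L - T).
Proof.
move=> h; elim: h T => {z w L} [z hz T hT|f a b w L hf ha hb hL IH T hT].
  by exists z; rewrite (_ : T = 0) ?Rminus_0_r; [split; exact: kchain_nil | lra].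
case: (Rle_lt_dec T (poincare a b)) => hTp.
  have [c [hc [ac cb]]] := poincare_between a b T ha hb (conj (proj1 hT) hTp).
  exists (f c); rewrite -ac; split.
    rewrite -[poincare a c]Rplus_0_r; apply: kchain_cons => //.
    by apply: kchain_nil; case: (hf c hc).
  rewrite (_ : _ - _ = poincare c b + L); first exact: kchain_cons.
  by rewrite cb -ac; ring.
have [|c [h1 h2]] := IH (T - poincare a b); first lra.
exists c; split; first by rewrite (_ : T = poincare a b + (T - poincare a b));
  [exact: kchain_cons | ring].
by rewrite (_ : _ - T = L - (T - poincare a b)) //; ring.
Qed.

Hypothesis Hyp : kobayashi_hyperbolic Om.

(** The function [real] sends an infinite infimum to 0. The value minus infinity is excluded because
    lengths are nonnegative. Plus infinity would mean that no chain exists: this fails for equal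
    points, and for distinct ones it would give distance 0 against hyperbolicity. *)
Lemma kobd_spec (z w : pt d) : Om z -> Om w ->
  (forall L, kchain Om z w L -> kobd Om z w <= L) /\
  (forall e, 0 < e -> exists L, kchain Om z w L /\ L < kobd Om z w + e).
Proof.
move=> hz hw.
have [lb glb] := Glb_Rbar_correct (kob_chain Om z w).
have lb0 : is_lb_Rbar (kob_chain Om z w) 0.
  by move=> L /kob_chain_kchain /kchain_ge0.
have := glb _ lb0; rewrite /kobd.
case E : (Glb_Rbar _) lb glb => [k||] //= lb glb _.
  split=> [L /kchain_kob_chain /lb //|e he].
  apply: NNPP => h; suff: k + e <= k by lra.
  apply: (glb (k + e)) => L hL /=; apply: Rnot_lt_le => hlt; apply: h.
  by exists L; split => //; exact: kob_chain_kchain.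
have [zw|zw] := classic (z = w).
  by case: (lb 0); rewrite zw; apply: kchain_kob_chain; apply: kchain_nil.
by have := proj2 Hyp z w hz hw zw; rewrite /kobd E /=; lra.
Qed.

Lemma kobd_ge0 (z w : pt d) : Om z -> Om w -> 0 <= kobd Om z w.
Proof.
move=> hz hw; apply: Rnot_lt_le => h; have [_ ap] := kobd_spec z w hz hw.
have [|L [/kchain_ge0 hL]] := ap (- kobd Om z w); lra.
Qed.

Lemma kobd_refl (z : pt d) : Om z -> kobd Om z z = 0.
Proof.
move=> hz; apply: Rle_antisym; last exact: kobd_ge0.
by apply: (proj1 (kobd_spec z z hz hz)); apply: kchain_nil.
Qed.

Lemma kobd_sym (z w : pt d) : kobd Om z w = kobd Om w z.
Proof.
congr real; apply: Glb_Rbar_eqset => L.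
by split=> /kob_chain_kchain /kchain_sym /kchain_kob_chain.
Qed.

Lemma kobd_triangle (z w u : pt d) : Om z -> Om w -> Om u ->
  kobd Om z u <= kobd Om z w + kobd Om w u.
Proof.
move=> hz hw hu; apply: le_epsilon => e he.
have [L [hL1 hL2]] := proj2 (kobd_spec z w hz hw) (e / 2) ltac:(lra).
have [M [hM1 hM2]] := proj2 (kobd_spec w u hw hu) (e / 2) ltac:(lra).
by have := proj1 (kobd_spec z u hz hu) _ (kchain_cat _ _ _ _ _ hL1 hM1); lra.
Qed.

(* Splitting a nearly optimal chain replaces the geodesic from [z] to [w]. *)
Lemma kobd_almost_geodesic (z w : pt d) (T : R) : Om z -> Om w ->
  0 <= T <= kobd Om z w ->
  exists c, Om c /\ kobd Om z c <= T /\ kobd Om c w <= kobd Om z w - T + 1.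
Proof.
move=> hz hw hT.
have [lb ap] := kobd_spec z w hz hw; have [L [hL hLk]] := ap 1 Rlt_0_1.
have [|c [h1 h2]] := kchain_split z w L T hL; first by have := lb _ hL; lra.
have [_ hc] := kchain_in _ _ _ h1; exists c; split => //.
have := proj1 (kobd_spec z c hz hc) _ h1.
by have := proj1 (kobd_spec c w hc hw) _ h2; lra.
Qed.
End Chains.

(** * The Euclidean distance *)

Lemma sqrt_triangle (a b c e : R) :
  sqrt ((a + b) ^ 2 + (c + e) ^ 2) <= sqrt (a ^ 2 + c ^ 2) + sqrt (b ^ 2 + e ^ 2).
Proof. exact: (Cmod_triangle (a, c) (b, e)). Qed.

(** Minkowski's inequality by induction on the coordinates; the step is the planar triangle
    inequality, taken from [Cmod]. *)
Lemma pnorm_triangle {d : nat} (x y : pt d) :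
  pnorm (fun j => x j + y j)%C <= pnorm x + pnorm y.
Proof.
suff: forall s : seq 'I_d, let N (x : pt d) := \big[Rplus/0]_(j <- s) Cmod (x j) ^ 2 in
    sqrt (N (fun j => x j + y j)%C) <= sqrt (N x) + sqrt (N y) by apply.
elim=> [|i s IH]; first by rewrite /= !big_nil sqrt_0; lra.
have N0 (u : pt d) : 0 <= \big[Rplus/0]_(j <- s) Cmod (u j) ^ 2.
  by apply: big_ind => *; [lra | lra | exact: pow2_ge_0].
move: IH; cbv beta zeta; rewrite !big_cons.
set A := \big[_/_]_(_ <- _) _; set B := \big[_/_]_(_ <- _) _.
set C := \big[_/_]_(_ <- _) _ => IH.
have [hA hB hC] : [/\ 0 <= A, 0 <= B & 0 <= C] by split; apply: N0.
apply: (Rle_trans _ (sqrt ((Cmod (x i) + Cmod (y i)) ^ 2 + (sqrt B + sqrt C) ^ 2))).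
  rewrite -{1}(pow2_sqrt A hA).
  apply: sqrt_le_1_alt; apply: Rplus_le_compat; apply: pow_incr.
    by split; [exact: Cmod_ge_0 | exact: Cmod_triangle].
  split; first exact: sqrt_pos.
  exact: IH.
apply: Rle_trans (sqrt_triangle _ _ _ _) _.
by rewrite (pow2_sqrt B) // (pow2_sqrt C) //; exact: Rle_refl.
Qed.

(** * Boundary points and Gromov products *)

Lemma pdist_triangle {d : nat} (x y z : pt d) : pdist x z <= pdist x y + pdist y z.
Proof.
rewrite /pdist (_ : (fun j => x j - z j)%C = fun j => (x j - y j + (y j - z j))%C).
  exact: pnorm_triangle.
by apply: functional_extensionality => j; ring.
Qed.

Lemma pdist_sym {d : nat} (x y : pt d) : pdist x y = pdist y x.
Proof.
congr (sqrt _); apply: eq_bigr => j _; rewrite -Cmod_opp.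
by congr (Cmod _ ^ _); ring.
Qed.

Lemma pdist_refl {d : nat} (x : pt d) : pdist x x = 0.
Proof.
rewrite /pdist /pnorm -[RHS]sqrt_0; congr sqrt.
apply: (big_ind (fun t => t = 0)) => [//|a b -> ->|j _]; first exact: Rplus_0_r.
by rewrite /Cminus Cplus_opp_r Cmod_0; ring.
Qed.

Lemma pdist_small {d : nat} (x y : pt d) : (forall r, 0 < r -> pdist x y <= r) -> x = y.
Proof.
move=> h; apply: functional_extensionality => i.
have S0 (u : pt d) : 0 <= \big[Rplus/0]_j Cmod (u j) ^ 2.
  by apply: big_ind => *; [lra | lra | exact: pow2_ge_0].
have d0 : pdist x y = 0.
  apply: Rle_antisym; last exact: sqrt_pos.
  by apply: le_epsilon => e he; rewrite Rplus_0_l; apply: h.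
have : Cmod (x i - y i)%C <= 0; last first.
  move=> h0; apply/Ceq_minus/Cmod_eq_0/Rle_antisym => //; exact: Cmod_ge_0.
have s0 := sqrt_eq_0 _ (S0 _) d0.
(* A single squared coordinate is at most the whole sum, which is 0 here. *)
have : forall s : seq 'I_d, i \in s ->
    Cmod (x i - y i)%C ^ 2 <= \big[Rplus/0]_(j <- s) Cmod (x j - y j)%C ^ 2.
  elim=> // j s IH; rewrite in_cons big_cons.
  have N0 : 0 <= \big[Rplus/0]_(j <- s) Cmod (x j - y j)%C ^ 2.
    by apply: big_ind => *; [lra | lra | exact: pow2_ge_0].
  case/orP => [/eqP <-|/IH h1]; first lra.
  by have := pow2_ge_0 (Cmod (x j - y j)%C); lra.
move=> /(_ (index_enum 'I_d) (mem_index_enum i)); rewrite s0.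
by have := Cmod_ge_0 (x i - y i)%C; nra.
Qed.

Lemma LimInf_seq_ge (u : nat -> R) (N : R) :
  (exists n0, forall n, (n0 <= n)%N -> N <= u n) -> Rbar_le N (LimInf_seq u).
Proof.
move=> [n0 h]; rewrite -(is_LimInf_seq_unique _ _ (is_LimInf_seq_const N)).
by apply: LimInf_le; exists n0 => n /leP; apply: h.
Qed.

(** The strict loss from [N] to [M] accounts for many of the additive constants in the thresholds
    chosen below. *)
Lemma LimInf_seq_gt (u : nat -> R) (N M : R) : M < N ->
  Rbar_le N (LimInf_seq u) -> exists n0, forall n, (n0 <= n)%N -> M < u n.
Proof.
move=> hMN; rewrite /LimInf_seq; case: (ex_LimInf_seq u) => [[l||]] //= hl hN.
  have [_ [n0 h]] := hl (mkposreal (N - M) (proj2 (Rlt_0_minus M N) hMN)).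
  by exists n0 => n /leP /h /=; lra.
by have [n0 h] := hl M; exists n0 => n /leP /h.
Qed.

Section GromovBoundary.
Context {d : nat} (Om : pt d -> Prop) (p : pt d) (delta : R).
Hypotheses (Hyp : kobayashi_hyperbolic Om) (Omp : Om p).
Hypothesis Hdelta : forall o x y z, Om o -> Om x -> Om y -> Om z ->
  gprod Om o x z >= Rmin (gprod Om o x y) (gprod Om o y z) - delta.

Lemma gprod_sym (o x y : pt d) : gprod Om o x y = gprod Om o y x.
Proof. by rewrite /gprod (kobd_sym Om x y); field. Qed.

Lemma gprod_refl (o x : pt d) : Om x -> gprod Om o x x = kobd Om x o.
Proof. by move=> hx; rewrite /gprod kobd_refl //; field. Qed.

Lemma gprod_trans (o x y z : pt d) (M : R) : Om o -> Om x -> Om y -> Om z ->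
  M <= gprod Om o x y -> M <= gprod Om o y z -> M - delta <= gprod Om o x z.
Proof.
move=> ho hx hy hz h1 h2; have := Hdelta _ _ _ _ ho hx hy hz.
by have := Rmin_glb _ _ _ h1 h2; lra.
Qed.

Lemma gprod_lipschitz (x y z : pt d) : Om x -> Om y -> Om z ->
  gprod Om p x z - kobd Om x y <= gprod Om p y z.
Proof.
move=> hx hy hz; rewrite /gprod.
have := kobd_triangle Om Hyp x y p hx hy Omp.
have := kobd_triangle Om Hyp y x z hy hx hz.
by rewrite (kobd_sym Om y x); lra.
Qed.

Lemma gprod_change_base (o x y : pt d) : Om o -> Om x -> Om y ->
  gprod Om p x y - kobd Om p o <= gprod Om o x y.
Proof.
move=> ho hx hy; rewrite /gprod.
have := kobd_triangle Om Hyp x o p hx ho Omp.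
have := kobd_triangle Om Hyp y o p hy ho Omp.
by rewrite (kobd_sym Om o p); lra.
Qed.

(** The sequence defining the class belongs to it: the diagonal case [m = n] of [conv_inf] makes it
    equivalent to itself. *)
Lemma gbdry_repr (xi : gclass d) : gbdry Om p xi -> exists s, xi s.
Proof.
move=> [s [hs hxi]]; exists s; apply/hxi; split=> // M.
by have [_ /(_ M) [N h]] := hs; exists N => n hn; apply: h.
Qed.

Lemma gbdry_conv (xi : gclass d) (s : nat -> pt d) (n : nat) :
  gbdry Om p xi -> xi s -> Om (s n).
Proof. by move=> [t [_ h]] /h [[hs _] _]. Qed.

(* The sets [gprod_ge q xi N] need not be open for [gopen]; the open set is the
   interior of such a set. *)
Lemma gprod_ge_open (xi : gclass d) (N : R) : gbdry Om p xi ->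
  exists U, gopen Om p U /\ U (inr xi) /\
    forall z, U (inl z) -> gprod_ge Om p (inl z) xi N.
Proof.
move=> hxi.
pose V q := gprod_ge Om p q xi N.
(* [U] consists of the points that have a basic neighbourhood, in the sense of [gopen], contained in
   [V]. *)
pose U (q : pt d + gclass d) := gpoint Om p q /\ match q with
  | inl z => exists r, 0 < r /\ forall w, Om w -> kobd Om z w < r -> V (inl w)
  | inr eta => exists M, forall q', gpoint Om p q' -> gprod_ge Om p q' eta M -> V q'
  end.
exists U; split; last first.
  split; first by split => //; exists N.
  by move=> z [hz [r [r0 h]]]; apply: h; rewrite ?kobd_refl.
split; first by move=> q [].
split=> [z [hz [r [r0 h]]]|eta [heta [M hM]]].
  exists (r / 2); split; first lra.
  move=> w hw zw; split => //; exists (r / 2); split; first lra.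
  move=> u hu wu; apply: h => //.
  by have := kobd_triangle Om Hyp z w u hz hw hu; lra.
(* The margin pays for one use of hyperbolicity when [q] is ideal, or for a move of length 1 when
   [q] is in [Om], and for the strict loss in passing from lower limits to terms. *)
exists (M + Rabs delta + 2) => q hq hqeta; split => //.
have dd := Rle_abs delta.
case: q hq hqeta => [z|zeta] hq hqeta.
  exists 1; split; first lra.
  move=> w hw zw; apply: hM => // s hs; apply: LimInf_seq_ge.
  have [|n0 hn0] := LimInf_seq_gt _ _ (M + 1) _ (hqeta s hs); first by have := Rabs_pos delta; lra.
  exists n0 => n /hn0 hn.
  by have := gprod_lipschitz z w (s n) hq hw (gbdry_conv _ _ n heta hs); lra.
(* A representative [t] of the ideal point links its neighbours to [eta]: both products through
   [t n] are large, and hyperbolicity combines them. *)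
have [t ht] := gbdry_repr _ hq.
exists (M + Rabs delta + 2) => -[w hw|theta htheta] hwz; apply: hM => //.
  move=> s hs; apply: LimInf_seq_ge.
  have [|n1 h1] := LimInf_seq_gt _ _ (M + Rabs delta) _ (hqeta s t hs ht); first lra.
  have [|n2 h2] := LimInf_seq_gt _ _ (M + Rabs delta) _ (hwz t ht); first lra.
  exists (maxn n1 n2) => n; rewrite geq_max => /andP [/h1 g1 /h2 g2].
  have := gprod_trans p w (t n) (s n) (M + Rabs delta) Omp hw
    (gbdry_conv _ _ n hq ht) (gbdry_conv _ _ n heta hs).
  by lra.
move=> s u hs hu; apply: LimInf_seq_ge.
have [|n1 h1] := LimInf_seq_gt _ _ (M + Rabs delta) _ (hqeta s t hs ht); first lra.
have [|n2 h2] := LimInf_seq_gt _ _ (M + Rabs delta) _ (hwz t u ht hu); first lra.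
exists (maxn n1 n2) => n; rewrite geq_max => /andP [/h1 g1 /h2 g2].
have := gprod_trans p (u n) (t n) (s n) (M + Rabs delta) Omp
  (gbdry_conv _ _ n htheta hu) (gbdry_conv _ _ n hq ht) (gbdry_conv _ _ n heta hs).
by lra.
Qed.

Hypothesis Hext : id_extends_homeo Om p.

(** The first estimate is continuity of the inverse homeomorphism at [x], the second is continuity
    of the homeomorphism at [xi], both restricted to points of [Om]. *)
Lemma boundary_gbdry (x : pt d) : boundary Om x -> exists xi, gbdry Om p xi /\
  (forall N, exists r, 0 < r /\
     forall w, Om w -> pdist x w < r -> gprod_ge Om p (inl w) xi N) /\
  (forall r, 0 < r -> exists N,
     forall z, Om z -> gprod_ge Om p (inl z) xi N -> pdist x z < r).
Proof.
move=> [cx nx]; have [h [hid [him [hinj [hsurj hopen]]]]] := Hext.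
have cl z : Om z -> closure_set Om z.
  by move=> hz r r0; exists z; split=> //; rewrite pdist_refl.
(* A preimage of [x] inside [Om] would be fixed by [h], which would put [x] in [Om]. *)
have [[z|xi] [hq hx]] := hsurj (inl x) cx.
  by case: nx; move: (hid z hq); rewrite hx => -[->].
exists xi; split=> //; split=> [N|r r0].
  have [U [oU [Uxi UV]]] := gprod_ge_open xi N hq.
  have /(hopen U (proj1 oU)) [_ [/(_ x) hE _]] := oU.
  have [|r [r0 hr]] := hE; first by exists (inr xi).
  exists r; split=> // w hw xw; apply: UV.
  have [|q [Uq hqw]] := hr w (cl w hw); first exact: xw.
  have <- // : q = inl w.
  by apply: hinj; rewrite ?hid //; exact: (proj1 oU).
(* [E] is the Euclidean ball about [x] in the closure, without any end. It is open in the end-point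
   topology, so its preimage [U] is a Gromov neighbourhood of [xi]. *)
pose E (y : pt d + eclass d) :=
  if y is inl z then closure_set Om z /\ pdist x z < r else False.
pose U q := gpoint Om p q /\ E (h q).
have UE : forall y, (exists q, U q /\ h q = y) <-> E y.
  move=> y; split=> [[q [[_ hE] <-]] //|Ey].
  have [|q [hq' hqy]] := hsurj y; first by case: y Ey => // z [].
  by exists q; rewrite /U hqy.
have : gopen Om p U.
  apply/hopen; first by move=> q [].
  split; first by move=> y /UE; case: y => // z [].
  split=> [z /UE [hz xz]|e /UE []].
  exists (r - pdist x z); split; first lra.
  move=> y hy zy; apply/UE; split=> //.
  by have := pdist_triangle x z y; lra.
move=> [_ [_ /(_ xi)]] [|N hN].
  split=> //; rewrite hx; split=> //.
  by rewrite pdist_refl.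
by exists N => z hz /(hN (inl z) hz) [_]; rewrite hid // => -[].
Qed.

(** Both [u] and [w] have large products with the same far term of a sequence representing [xi].
    Hyperbolicity costs [delta] and the change of pole costs the distance from [p] to [o]. *)
Lemma gprod_near_boundary (o x : pt d) (N : R) : Om o -> boundary Om x ->
  exists r, 0 < r /\ forall u w, Om u -> Om w -> pdist x u < r -> pdist x w < r ->
    N <= gprod Om o u w.
Proof.
move=> ho hx; have [xi [hxi [near _]]] := boundary_gbdry x hx.
pose M := N + Rabs delta + kobd Om p o.
have [r [r0 hr]] := near (M + 1); exists r; split=> // u w hu hw xu xw.
have [s hs] := gbdry_repr _ hxi.
have [|n1 h1] := LimInf_seq_gt _ _ M _ (hr u hu xu s hs); first lra.
have [|n2 h2] := LimInf_seq_gt _ _ M _ (hr w hw xw s hs); first lra.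
pose n := maxn n1 n2.
have g1 := h1 n (leq_maxl _ _); have g2 := h2 n (leq_maxr _ _).
rewrite gprod_sym in g2; have sn := gbdry_conv _ _ n hxi hs.
have := gprod_trans p u (s n) w M Omp hu sn hw (Rlt_le _ _ g1) (Rlt_le _ _ g2).
have := gprod_change_base o u w ho hu hw; have := Rle_abs delta.
by rewrite /M; lra.
Qed.

(** Since [w] is close to [xi], a large product of [z] with [w] forces [z] close to [xi] by
    hyperbolicity, hence close to [x]. *)
Lemma gprod_large_near_boundary (o x : pt d) (r : R) : Om o -> boundary Om x -> 0 < r ->
  exists N r', 0 < r' /\ forall z w, Om z -> Om w -> pdist x w < r' ->
    N <= gprod Om o z w -> pdist x z < r.
Proof.
move=> ho hx r0; have [xi [hxi [near far]]] := boundary_gbdry x hx.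
have [N hN] := far r r0; pose M := N + Rabs delta.
have [r' [r'0 hr']] := near (M + 1).
exists (M + kobd Om p o), r'; split=> // z w hz hw xw hzw.
apply: hN => // s hs; apply: LimInf_seq_ge.
have [|n0 h0] := LimInf_seq_gt _ _ M _ (hr' w hw xw s hs); first lra.
exists n0 => n /h0 g; have sn := gbdry_conv _ _ n hxi hs.
have hb : M <= gprod Om p z w.
  have := kobd_triangle Om Hyp z p o hz Omp ho.
  have := kobd_triangle Om Hyp w p o hw Omp ho.
  by move: hzw; rewrite /gprod; lra.
have := gprod_trans p z w (s n) M Omp hz hw sn hb (Rlt_le _ _ g).
by have := Rle_abs delta; rewrite /M; lra.
Qed.

(** * Closures of the horospheres at the boundary *)

Lemma small_horosphere_big (o x : pt d) (R0 : R) (z : pt d) : boundary Om x ->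
  small_horosphere Om o x R0 z -> big_horosphere Om o x R0 z.
Proof.
move=> [cx nx] [hz [c [hc [r [r0 h]]]]]; split=> //.
(* The midpoint turns the weak bound by [c] into the strict one asked for by [liminf_lt]. *)
exists ((c + ln R0 / 2) / 2); split; first lra.
move=> r1 r10; have [|w [hw xw]] := cx (Rmin r r1); first exact: Rmin_pos.
have [xr xr1] := (Rmin_l r r1, Rmin_r r r1).
have wx : w <> x by move=> e; apply: nx; rewrite -e.
exists w; rewrite pdist_sym; do !split => //; first lra.
by have := h w hw; rewrite pdist_sym => /(_ ltac:(lra) wx); lra.
Qed.

Lemma big_horosphere_boundary (o x y : pt d) (R0 : R) : Om o ->
  boundary Om x -> boundary Om y -> closure_set (big_horosphere Om o x R0) y -> y = x.
Proof.
move=> ho hx hy cy; apply: pdist_small => r r0.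
have r20 : 0 < r / 2 by lra.
have [N [r' [r'0 hN]]] := gprod_large_near_boundary o x (r / 2) ho hx r20.
(* Twice the product of [z] and [w] exceeds [kobd Om z o - ln R0 / 2], so this lower bound on
   [kobd Om z o] makes the product at least [N]. *)
have [r1 [r10 h1]] := gprod_near_boundary o y (2 * N + ln R0 / 2) ho hy.
have [|z [[hz [c [hc hlim]]] yz]] := cy (Rmin (r / 2) r1); first exact: Rmin_pos.
have [m1 m2] := (Rmin_l (r / 2) r1, Rmin_r (r / 2) r1).
have [w [hw [wx [_ hzw]]]] := hlim r' r'0.
have zr1 : pdist y z < r1 by lra.
(* The product of [z] with itself is its distance to [o], which is therefore large near [y]. *)
have hk := h1 z z hz hz zr1 zr1; rewrite gprod_refl // in hk.
have xz : pdist x z < r / 2.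
  apply: (hN z w) => //; first by rewrite pdist_sym.
  by rewrite /gprod (kobd_sym Om w o); lra.
by have := pdist_triangle y z x; rewrite (pdist_sym z x); lra.
Qed.

Lemma small_horosphere_boundary (o x : pt d) (R0 : R) : Om o ->
  boundary Om x -> closure_set (small_horosphere Om o x R0) x.
Proof.
move=> ho hx r r0.
have [N [r' [r'0 hN]]] := gprod_large_near_boundary o x r ho hx r0.
(* Two bounds are needed: [T - 1 >= N] brings [z] close to [x], and
   [T - 2 * (T - 1 - delta) <= ln R0 / 2 - 1] puts it in the small horosphere. *)
pose T := Rabs N + Rabs (ln R0 / 2) + 2 * Rabs delta + 3.
have [r1 [r10 h1]] := gprod_near_boundary o x T ho hx.
have [|u [hu xu]] := proj1 hx (Rmin r' r1); first exact: Rmin_pos.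
have [m1 m2] := (Rmin_l r' r1, Rmin_r r' r1).
have xu' : pdist x u < r' by lra.
have xu1 : pdist x u < r1 by lra.
have hk := h1 u u hu hu xu1 xu1; rewrite gprod_refl // kobd_sym in hk.
have T0 : 0 <= T.
  have := Rabs_pos N; have := Rabs_pos (ln R0 / 2); have := Rabs_pos delta.
  by rewrite /T; lra.
have [z [hz [oz zu]]] := kobd_almost_geodesic Om Hyp o u T ho hu (conj T0 hk).
(* The excess 1 of the almost geodesic enters twice, in the distance from [z] to [u] and in the
   lower bound [T - 1] for that from [o] to [z]; the product halves the sum. *)
have ozu : T - 1 <= gprod Om o z u.
  have := kobd_triangle Om Hyp o z u ho hz hu.
  by rewrite /gprod (kobd_sym Om z o) (kobd_sym Om u o); lra.
have ozw w : Om w -> pdist x w < r1 -> T - 1 - delta <= gprod Om o z w.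
  move=> hw xw; apply: (gprod_trans o z u w) => //.
  by have := h1 u w hu hw xu1 xw; lra.
have [d1 [n1 c1]] := (Rle_abs delta, (Rle_abs N, Rle_abs (- (ln R0 / 2)))).
rewrite Rabs_Ropp in c1.
have [c2 n2] := (Rabs_pos (ln R0 / 2), Rabs_pos N); have d2 := Rabs_pos delta.
exists z; split; last by apply: (hN z u) => //; rewrite /T in ozu; lra.
split=> //; exists (ln R0 / 2 - 1); split; first lra.
exists r1; split=> // w hw wx _; rewrite pdist_sym in wx.
have := ozw w hw wx; rewrite /gprod (kobd_sym Om z o) (kobd_sym Om w o).
by rewrite /T in oz *; lra.
Qed.
End GromovBoundary.

Theorem theorem1p3 (d : nat) (Om : pt d -> Prop) :
  model_gromov_hyperbolic Om ->
  forall (x o : pt d) (R0 : R),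
    boundary Om x -> Om o -> 0 < R0 ->
    (forall y, (closure_set (small_horosphere Om o x R0) y /\ boundary Om y) <-> y = x) /\
    (forall y, (closure_set (big_horosphere Om o x R0) y /\ boundary Om y) <-> y = x).
Proof.
move=> [Hyp [[delta [_ Hd]] [p [Omp Hext]]]] x o R0 hx ho _.
(* By this inclusion, uniqueness for the big horosphere and membership of [x] for the small one
   settle both equalities. *)
have sb y : closure_set (small_horosphere Om o x R0) y ->
    closure_set (big_horosphere Om o x R0) y.
  move=> h r /h [z [hz yz]]; exists z; split=> //.
  exact: small_horosphere_big.
have bx y : boundary Om y -> closure_set (big_horosphere Om o x R0) y -> y = x.
  exact: (big_horosphere_boundary Om p delta).
have sx : closure_set (small_horosphere Om o x R0) x.
  exact: (small_horosphere_boundary Om p delta).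
split=> y; split=> [[h hy]|->]; try by split; auto.
  by apply: bx => //; apply: sb.
exact: bx.
Qed.
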